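(* Let $n,d,K\in\mathbb{N}$ and let $f_1,\dots,f_n:\mathbb{R}^d\to\mathbb{R}$ be differentiable, with $f=\frac1n\sum_{i=1}^n f_i$. Assume: (i) there exists $\mathbf{x}_\star\in\mathbb{R}^d$ with $f_\star:=f(\mathbf{x}_\star)=\inf_{\mathbf{x}\in\mathbb{R}^d}f(\mathbf{x})\in\mathbb{R}$; (ii) each $f_i$ is convex; (iii) each $f_i$ is $L_i$-smooth for some $L_i>0$. Run Shuffling SGD from $\mathbf{x}_1^1\in\mathbb{R}^d$ for $K$ epochs under Random Reshuffling with stepsizes satisfying $0<\eta_k\le\frac{1}{6\hat L}$ for all $k\in\{1,\dots,K\}$. Let $$\bar{\mathbf{x}}_K:=\sum_{k=1}^K\sum_{i=1}^n\frac{\eta_k}{nH_K}\mathbf{x}_k^i,\qquad H_K:=\sum_{k=1}^K\eta_k.$$ Then $$\mathbb{E}\left[f(\bar{\mathbf{x}}_K)-f_\star\right]\le\frac{6\|\mathbf{x}_1^1-\mathbf{x}_\star\|^2}{n\sum_{k=1}^K\eta_k}+51\min\left\{\frac{\sum_{k=1}^K\eta_k^2}{\sum_{k=1}^K\eta_k},\ \frac{\sum_{k=1}^K\eta_k^3\,n\bar L}{\sum_{k=1}^K\eta_k}\right\}\sigma_\star^2.$$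
   Context: $\|\cdot\|$ is the Euclidean norm on $\mathbb{R}^d$. A differentiable $h$ is $L$-smooth if $\|\nabla h(\mathbf{x})-\nabla h(\mathbf{y})\|\le L\|\mathbf{x}-\mathbf{y}\|$ for all $\mathbf{x},\mathbf{y}\in\mathbb{R}^d$. Notation: $\bar L:=\frac1n\sum_{i=1}^nL_i$, $\hat L:=\max_{1\le i\le n}L_i$, $\sigma_\star^2:=\frac1n\sum_{i=1}^n\|\nabla f_i(\mathbf{x}_\star)\|^2$. Shuffling SGD: given a (deterministic) initial point $\mathbf{x}_1^1\in\mathbb{R}^d$ and (deterministic) stepsizes $\eta_1,\dots,\eta_K>0$, for each epoch $k=1,\dots,K$ generate a permutation $\pi_k=(\pi_k^1,\dots,\pi_k^n)$ of $\{1,\dots,n\}$, set $\mathbf{x}_k^{i+1}=\mathbf{x}_k^i-\eta_k\nabla f_{\pi_k^i}(\mathbf{x}_k^i)$ for $i=1,\dots,n$, and then $\mathbf{x}_{k+1}^1=\mathbf{x}_k^{n+1}$. Random Reshuffling: $\pi_1,\dots,\pi_K$ are drawn independently and uniformly from the set of all permutations of $\{1,\dots,n\}$. $\mathbb{E}$ is the expectation over these permutations. *)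

(* Defs.v *)
From HB Require Import structures.
From mathcomp Require Import all_boot all_order all_algebra perm.
From mathcomp Require Import all_classical all_reals all_analysis.
Set Implicit Arguments.
Unset Strict Implicit.
Unset Printing Implicit Defensive.
Import Order.TTheory GRing.Theory Num.Theory numFieldNormedType.Exports.
Local Open Scope classical_set_scope.
Local Open Scope ring_scope.

(* Permutations carry the discrete sigma-algebra, so that a random permutation
   is a random variable {RV P >-> {perm aT}}. The instances are keyed on
   [perm_type], which [perm_of] unfolds to. *)
HB.instance Definition _ (aT : finType) :=
  isPointed.Build (perm_type aT) (1%g : {perm aT}).
HB.instance Definition _ (aT : finType) :=
  @isMeasurable.Build default_measure_display (perm_type aT) discrete_measurable
    discrete_measurable0 discrete_measurableC discrete_measurableU.

Section Probability.
Context d (T : measurableType d) (R : realType).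
Variable P : probability T R.

(* Factors of a subfamily are obtained by taking [A i := setT] elsewhere. *)
Definition mutually_independent d' (T' : measurableType d') (I : finType)
    (X : I -> {RV P >-> T'}) : Prop :=
  forall A : I -> set T', (forall i, measurable (A i)) ->
    P (\bigcap_i (X i @^-1` A i)) = (\prod_(i : I) P (X i @^-1` A i))%E.

Definition uniform_perm n (s : {RV P >-> 'S_n}) : Prop :=
  forall p : 'S_n, P (s @^-1` [set p]) = (n`!%:R^-1)%:E.

Definition random_reshuffling n K (s : 'I_K -> {RV P >-> 'S_n}) : Prop :=
  (forall k, uniform_perm (s k)) /\ mutually_independent s.

End Probability.

Section Euclidean.
Context (R : realType) (d : nat).
Implicit Types (x y : 'rV[R]_d) (h : 'rV[R]_d -> R).

(* The library's norm on ['rV[R]_d] is the sup norm. Both norms induce the same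
   topology, so [differentiable] is the usual notion. *)
Definition enorm x : R := Num.sqrt (\sum_(j < d) x 0 j ^+ 2).

Definition grad h x : 'rV[R]_d := \row_j 'D_(delta_mx 0 j) h x.

Definition smooth (L : R) h : Prop :=
  forall x y, enorm (grad h x - grad h y) <= L * enorm (x - y).

End Euclidean.

Section ShufflingSGD.
Context (R : realType) (n d K : nat).
Variables (f : 'I_n -> 'rV[R]_d -> R) (eta : 'I_K -> R).

Definition objective (x : 'rV[R]_d) : R := n%:R^-1 * \sum_(i < n) f i x.

Definition Lbar (L : 'I_n -> R) : R := n%:R^-1 * \sum_(i < n) L i.

(* The default 0 is harmless: the smoothness constants are positive. *)
Definition Lhat (L : 'I_n -> R) : R := \big[Num.max/0]_(i < n) L i.

Definition sigma2 (xstar : 'rV[R]_d) : R :=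
  n%:R^-1 * \sum_(i < n) enorm (grad (f i) xstar) ^+ 2.

(* Epochs and inner steps are numbered from 0: [x k i] is the point of epoch k
   after i steps. Only the values with k < K, i <= n, and [x K 0], are
   constrained. *)
Definition shuffling_sgd (s : 'I_K -> 'S_n) (x0 : 'rV[R]_d)
    (x : nat -> nat -> 'rV[R]_d) : Prop :=
  [/\ x 0%N 0%N = x0,
      forall (k : 'I_K) (i : 'I_n),
        x k i.+1 = x k i - eta k *: grad (f (s k i)) (x k i)
    & forall k : 'I_K, x k.+1 0%N = x k n].

Definition Hsum : R := \sum_(k < K) eta k.

Definition xbar (x : nat -> nat -> 'rV[R]_d) : 'rV[R]_d :=
  \sum_(k < K) \sum_(i < n) (eta k / (n%:R * Hsum)) *: x k i.

End ShufflingSGD.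

(* Main.v *)
(* Write b_i for the Bregman divergence of f_i relative to xstar, and let x and x'
   be the points after i steps of an epoch run with a uniform permutation pi and
   with pi composed with the transposition (i l).

   Since exchanging the positions i and l preserves the uniform law,
   n E[f(x) - f(xstar)] = sum_l E[b_{pi_i}(x')].  A gradient step of a convex smooth
   function is nonexpansive, so x' and x differ by at most one step difference
   eta |grad f_{pi_i}(x^l) - grad f_{pi_l}(x^l)|, whatever the size of eta n L.  Hence
   the suboptimality is controlled by beta = sum_i E[b_{pi_i}(x^i)] plus noise, and
   beta is bounded in two ways: expanding |x^{i+1} - xstar|^2, which gives the
   eta^2 sigma^2 term, or expanding the distance to the shadow trajectory
   xstar - eta sum_{j<i} grad f_{pi_j}(xstar), which returns to xstar at the end of
   the epoch and gives the eta^3 n Lbar sigma^2 term. *)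

Require Import Defs.
From HB Require Import structures.
From mathcomp Require Import all_boot all_order all_algebra perm.
From mathcomp Require Import all_classical all_reals all_analysis.
From mathcomp Require Import ring lra.
Set Implicit Arguments.
Unset Strict Implicit.
Unset Printing Implicit Defensive.
Import Order.TTheory GRing.Theory Num.Theory numFieldNormedType.Exports.
Local Open Scope classical_set_scope.
Local Open Scope ring_scope.

(** * The Euclidean inner product *)

Section InnerProduct.
Context (R : realType) (d : nat).
Implicit Types (x y z u v : 'rV[R]_d) (a : R).

Definition dot x y : R := \sum_(j < d) x 0 j * y 0 j.

Lemma dotC x y : dot x y = dot y x.
Proof. by apply: eq_bigr => j _; rewrite mulrC. Qed.

Lemma dotDl x y z : dot (x + y) z = dot x z + dot y z.
Proof. by rewrite -big_split; apply: eq_bigr => j _; rewrite mxE mulrDl. Qed.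

Lemma dotZl a x y : dot (a *: x) y = a * dot x y.
Proof. by rewrite big_distrr; apply: eq_bigr => j _; rewrite mxE /= mulrA. Qed.

Lemma dotNl x y : dot (- x) y = - dot x y.
Proof. by rewrite -scaleN1r dotZl mulN1r. Qed.

Lemma dotDr x y z : dot x (y + z) = dot x y + dot x z.
Proof. by rewrite dotC dotDl !(dotC x). Qed.

Lemma dotZr a x y : dot x (a *: y) = a * dot x y.
Proof. by rewrite dotC dotZl dotC. Qed.

Lemma dotNr x y : dot x (- y) = - dot x y.
Proof. by rewrite dotC dotNl dotC. Qed.

Definition dotE := (dotDl, dotDr, dotNl, dotNr, dotZl, dotZr).

Lemma dot0l x : dot 0 x = 0.
Proof. by rewrite -(scale0r 0) dotZl mul0r. Qed.

Lemma dot0r x : dot x 0 = 0.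
Proof. by rewrite dotC dot0l. Qed.

Lemma dot_suml (I : Type) (r : seq I) (P : pred I) (F : I -> 'rV[R]_d) y :
  dot (\sum_(i <- r | P i) F i) y = \sum_(i <- r | P i) dot (F i) y.
Proof.
by apply: (big_morph (dot^~ y)) => [u v|]; rewrite ?dotDl ?dot0l.
Qed.

Lemma dot_sumr (I : Type) (r : seq I) (P : pred I) (F : I -> 'rV[R]_d) y :
  dot y (\sum_(i <- r | P i) F i) = \sum_(i <- r | P i) dot y (F i).
Proof. by rewrite dotC dot_suml; apply: eq_bigr => i _; rewrite dotC. Qed.

Lemma dot_ge0 x : 0 <= dot x x.
Proof. by apply: sumr_ge0 => j _; rewrite -expr2 sqr_ge0. Qed.

Lemma dot_eq0 x : dot x x = 0 -> x = 0.
Proof.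
move=> x0; apply/rowP => j; rewrite mxE; apply/eqP; rewrite -sqrf_eq0.
have := x0; rewrite /dot => /eqP; rewrite psumr_eq0 => [/allP/(_ j)|k _].
  by rewrite mem_index_enum => /(_ isT).
by rewrite -expr2 sqr_ge0.
Qed.

Lemma enorm_sqr x : enorm x ^+ 2 = dot x x.
Proof. by rewrite sqr_sqrtr ?sumr_ge0// => j _; rewrite sqr_ge0. Qed.

Lemma dot_youngr a u v : 0 < a -> 2 * dot u v <= a * dot u u + a^-1 * dot v v.
Proof.
move=> a0; have := dot_ge0 (a *: u - v); rewrite !dotE (dotC v u) => h.
have -> : a * dot u u = a^-1 * (a * (a * dot u u)) by rewrite mulKf ?gt_eqF.
rewrite -mulrDr ler_pdivlMl//; lra.
Qed.

Lemma dotD_le u v : dot (u + v) (u + v) <= 2 * dot u u + 2 * dot v v.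
Proof. by have := dot_ge0 (u - v); rewrite !dotE (dotC v u); lra. Qed.

Lemma dotB_le u v : dot (u - v) (u - v) <= 2 * dot u u + 2 * dot v v.
Proof. by have := dotD_le u (- v); rewrite !dotNl !dotNr opprK. Qed.

End InnerProduct.

(** * First-order inequalities for convex and smooth functions *)

Section ConvexSmooth.
Context (R : realType) (d : nat).
Implicit Types (h : 'rV[R]_d -> R) (x y z v : 'rV[R]_d) (l : R).

Lemma derive_dot h x v : differentiable h x -> 'D_v h x = dot (grad h x) v.
Proof.
move=> dh; rewrite deriveE// {1}(row_sum_delta v) linear_sum/=.
apply: eq_bigr => j _; rewrite linearZ/= -deriveE// /grad mxE mulrC.
by [].
Qed.

(** Convexity bounds every difference quotient at x along y - x, for t in (0, 1], by h y - h x;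
    their limit from the right is the directional derivative. *)
Lemma convex_first_order h x y : differentiable h x ->
  convex_function [set: 'rV[R]_d] h -> h x + dot (grad h x) (y - x) <= h y.
Proof.
move=> dh ch; set v := y - x; rewrite -derive_dot// -lerBrDl.
have dv : derivable h x v by exact: diff_derivable.
have cv : (fun t : R => t^-1 *: (h (t *: v + x) - h x)) @ 0^'+ --> 'D_v h x.
  by apply: cvg_dnbhs_at_right; exact: dv.
rewrite -(cvg_lim _ cv)//; apply: limr_le; first by apply/cvg_ex; eexists; exact: cv.
near=> t.
have t0 : 0 < t by near: t; exact: nbhs_right_gt.
have t1 : t <= 1 by near: t; exact: nbhs_right_le.
have ht : t \in `[0, 1] by rewrite in_itv/= (ltW t0).
have hc : h (t *: y + (1 - t) *: x) <= t * h y + (1 - t) * h x :=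
  ch (Itv01 (ltW t0) t1) y x (in_setT _) (in_setT _).
rewrite /GRing.scale/= ler_pdivrMl// lerBlDr.
have -> : t *: v + x = t *: y + (1 - t) *: x.
  by rewrite /v scalerBr scalerBl scale1r addrA addrAC.
by apply: le_trans hc _; rewrite le_eqVlt; apply/orP; left; apply/eqP; ring.
Unshelve. all: by end_near. Qed.

End ConvexSmooth.

Section ConvexSmoothBounds.
Context (R : realType) (d : nat).
Implicit Types (h : 'rV[R]_d -> R) (x y z v : 'rV[R]_d) (l : R).

Lemma is_derive_line h x v (t : R) : differentiable h (t *: v + x) ->
  is_derive t (1 : R) (fun s : R => h (s *: v + x)) (dot (grad h (t *: v + x)) v).
Proof.
move=> dh; rewrite -derive_dot//.
have E : (fun e : R => e^-1 *: (((fun s : R => h (s *: v + x)) \o shift t) (e *: 1)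
      - h (t *: v + x))) =
    (fun e : R => e^-1 *: ((h \o shift (t *: v + x)) (e *: v) - h (t *: v + x))).
  by apply/funext => e /=; rewrite [e *: 1]mulr1 scalerDl addrA.
split; last by rewrite /derive E.
by have := diff_derivable (v := v) dh; rewrite /derivable E.
Qed.

Lemma smooth_dot l h x y : 0 <= l -> smooth l h ->
  dot (grad h x - grad h y) (grad h x - grad h y) <= l ^+ 2 * dot (x - y) (x - y).
Proof.
move=> l0 /(_ x y) sh; rewrite -!enorm_sqr -exprMn ler_sqr ?nnegrE//.
  exact: sqrtr_ge0.
by rewrite mulr_ge0 ?sqrtr_ge0.
Qed.

(** On the segment from x to y, [phi] is h minus the non-constant part of its quadratic upper model.
    Its derivative is nonpositive, so the mean value theorem gives phi 1 <= phi 0 without an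
    integral. *)
Lemma smooth_descent l h x y : 0 < l -> (forall z, differentiable h z) ->
  smooth l h ->
  h y <= h x + dot (grad h x) (y - x) + l / 2 * dot (y - x) (y - x).
Proof.
move=> l0 dh sh; set v := y - x; set g := dot (grad h x) v.
pose phi (t : R) := h (t *: v + x) - t * g - l / 2 * t ^+ 2 * dot v v.
pose dphi (t : R) := dot (grad h (t *: v + x)) v - g - l * t * dot v v.
have Dphi (t : R) : is_derive t (1 : R) phi (dphi t).
  have ? := is_derive_line (dh (t *: v + x)).
  have -> : phi = (fun s => h (s *: v + x)) - g *: id - (l / 2 * dot v v) *: (id ^+ 2).
    by apply/funext => s; rewrite /phi !fctE /GRing.scale/=; ring.
  apply: is_derive_eq; rewrite /dphi. by rewrite /GRing.scale/= !mulr1 expr1; field.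
have cphi : {within `[0, 1], continuous phi}.
  apply: derivable_within_continuous => t _; exact: (@ex_derive _ _ _ _ _ _ _ (Dphi t)).
have [c /[!in_itv]/= /andP[c0 c1] ] := MVT ltr01 (fun t _ => Dphi t) cphi.
rewrite subr0 mulr1 /phi /dphi.
rewrite scale1r scale0r add0r mul0r subr0 expr0n/= mulr0 mul0r subr0 mul1r expr1n mulr1.
rewrite {1}/v subrK -/v => E.
(* With this weight the Lipschitz bound makes both terms of Young's inequality at most l c |v|^2. *)
have := dot_youngr (grad h (c *: v + x) - grad h x) v (a := (l * c)^-1).
rewrite invr_gt0 mulr_gt0// => /(_ isT); rewrite invrK dotDl dotNl -/g => Y.
have := smooth_dot (c *: v + x) x (ltW l0) sh; rewrite addrK dotZl dotZr => S.
have : (l * c)^-1 * dot (grad h (c *: v + x) - grad h x)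
    (grad h (c *: v + x) - grad h x) <= l * c * dot v v.
  rewrite ler_pdivrMl ?mulr_gt0//; apply: le_trans S _.
  by rewrite le_eqVlt; apply/orP; left; apply/eqP; ring.
lra.
Qed.

End ConvexSmoothBounds.

(** * Bregman divergences of a convex smooth function *)

Definition bregman (R : realType) d (h : 'rV[R]_d -> R) (x y : 'rV[R]_d) : R :=
  h x - h y - dot (grad h y) (x - y).

Section Bregman.
Context (R : realType) (d : nat).
Variables (h : 'rV[R]_d -> R) (l : R).
Hypotheses (l0 : 0 < l) (dh : forall z, differentiable h z)
  (ch : convex_function [set: 'rV[R]_d] h) (sh : smooth l h).
Implicit Types (x y z : 'rV[R]_d).

Lemma bregman_ge0 x y : 0 <= bregman h x y.
Proof. by have := convex_first_order x (dh y) ch; rewrite /bregman; lra. Qed.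

Lemma bregman_le x y : bregman h x y <= l / 2 * dot (x - y) (x - y).
Proof. by have := smooth_descent y x l0 dh sh; rewrite /bregman; lra. Qed.

(** The value of h at z = x - g / l is bounded above by descent from x and below by the tangent at
    y; comparing the two leaves |g|^2 / (2 l) <= bregman h x y. *)
Lemma grad_sub_le_bregman x y :
  dot (grad h x - grad h y) (grad h x - grad h y) <= 2 * l * bregman h x y.
Proof.
set g := grad h x - grad h y; pose z := x - l^-1 *: g.
have zx : z - x = - (l^-1 *: g) by rewrite /z addrAC subrr add0r.
have zy : z - y = (z - x) + (x - y) by rewrite addrA subrK.
have := bregman_ge0 z y; have := smooth_descent x z l0 dh sh.
rewrite /bregman zy zx dotDr !(dotNr, dotZr) dotNl dotZl.
have -> : l / 2 * - (l^-1 * - (l^-1 * dot g g)) = l^-1 * dot g g / 2.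
  by field; rewrite gt_eqF.
have -> : dot g g = dot (grad h x) g - dot (grad h y) g.
  by rewrite {1}/g dotDl dotNl.
move=> H1 H2; rewrite mulrAC -ler_pdivrMr// mulrC; lra.
Qed.

(** Adding [grad_sub_le_bregman] in both orders gives cocoercivity, |g|^2 <= l <g, w>. Hence e^2
    |g|^2 <= e <g, w>, which the cross term - 2 e <g, w> absorbs. *)
Lemma gradient_step_nonexpansive (e : R) x y : 0 <= e -> e * l <= 1 ->
  let u := (x - e *: grad h x) - (y - e *: grad h y) in
  dot u u <= dot (x - y) (x - y).
Proof.
move=> e0 el /=; set g := grad h x - grad h y; set w := x - y.
have -> : x - e *: grad h x - (y - e *: grad h y) = w - e *: g.
  by rewrite /w /g scalerBr !opprD !opprK addrACA.
have G0 : 0 <= dot g g := dot_ge0 g.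
have gw : dot g g <= l * dot g w.
  have := grad_sub_le_bregman x y; have := grad_sub_le_bregman y x.
  rewrite -/g -(opprB (grad h x)) -/g dotNl dotNr opprK /bregman.
  rewrite -(opprB x y) -/w /g !dotDl !dotNl !dotNr; lra.
move: g w gw G0 => g w gw G0.
have w0 : 0 <= dot g w by rewrite -(pmulr_rge0 _ l0); exact: le_trans gw.
have : e * (e * dot g g) <= e * dot g w.
  rewrite ler_wpM2l//; apply: le_trans (ler_wpM2l e0 gw) _.
  by rewrite mulrA ler_piMl.
have : 0 <= e * dot g w by rewrite mulr_ge0.
rewrite !dotE (dotC w g); lra.
Qed.

(** Descent from y leaves the cross term <grad h y - grad h z, x - y>. Young's inequality with
    weight 1 / l splits it, and the gradient part is at most a second copy of [bregman h y z]. *)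
Lemma bregman_shift x y z :
  bregman h x z <= 2 * bregman h y z + l * dot (x - y) (x - y).
Proof.
set w := x - y; have := smooth_descent y x l0 dh sh.
have := dot_youngr (grad h y - grad h z) w (a := l^-1).
rewrite invr_gt0 invrK => /(_ l0).
have : l^-1 * dot (grad h y - grad h z) (grad h y - grad h z) <= 2 * bregman h y z.
  by rewrite ler_pdivrMl// mulrCA mulrA grad_sub_le_bregman.
have : dot (grad h z) (x - z) = dot (grad h z) w + dot (grad h z) (y - z).
  by rewrite -dotDr /w addrA subrK.
rewrite /bregman (dotDl (grad h y) _ w) dotNl -/w; lra.
Qed.

End Bregman.

(** A gradient step of length 1 / C on the sum, with C the sum of the L i, would lower it by at
    least |g|^2 / (2 C), so minimality forces g = 0. *)
Lemma grad_sum_minimizer (R : realType) n d (f : 'I_n -> 'rV[R]_d -> R)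
    (L : 'I_n -> R) (xstar : 'rV[R]_d) :
  (0 < n)%N -> (forall i, 0 < L i) -> (forall i z, differentiable (f i) z) ->
  (forall i, smooth (L i) (f i)) ->
  (forall z, objective f xstar <= objective f z) ->
  \sum_(i < n) grad (f i) xstar = 0.
Proof.
move=> n0 Lpos fdiff fsmooth fmin; set g := \sum_(i < n) _.
pose C := \sum_(i < n) L i; pose z := xstar - C^-1 *: g.
have C0 : 0 < C.
  rewrite /C (bigD1 (Ordinal n0))//= ltr_pwDl//.
  by apply: sumr_ge0 => i _; exact: ltW.
have zE : z - xstar = - (C^-1 *: g) by rewrite /z addrAC subrr add0r.
have : \sum_(i < n) f i xstar <= \sum_(i < n) f i z.
  by have := fmin z; rewrite /objective ler_pM2l// invr_gt0 ltr0n.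
have : \sum_(i < n) f i z <= \sum_(i < n) (f i xstar +
    dot (grad (f i) xstar) (z - xstar) + L i / 2 * dot (z - xstar) (z - xstar)).
  by apply: ler_sum => i _; exact: smooth_descent.
rewrite !big_split/= -dot_suml -!mulr_suml -/g -/C zE.
rewrite !(dotNr, dotNl, dotZr, dotZl) => H1 H2.
apply: dot_eq0; apply/eqP; rewrite eq_le dot_ge0 andbT.
have E : C / 2 * - - (C^-1 * (C^-1 * dot g g)) = C^-1 * dot g g / 2.
  by field; rewrite gt_eqF.
rewrite -(pmulr_rle0 _ (_ : 0 < C^-1)) ?invr_gt0//.
lra.
Qed.

(** * Sums over all permutations *)

Section PermutationSums.
Context (R : realType) (n : nat).
Implicit Types (p : 'S_n) (i j l : 'I_n).

Lemma sum_tpermM (F : 'S_n -> R) i j :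
  \sum_(p : 'S_n) F (tperm i j * p)%g = \sum_(p : 'S_n) F p.
Proof. by rewrite [RHS](reindex_inj (mulgI (tperm i j))). Qed.

Lemma sum_perm_cst (c : R) : \sum_(p : 'S_n) c = n`!%:R * c.
Proof. by rewrite sumr_const card_Sn mulr_natl. Qed.

(** Write m as p l, then substitute [tperm i l * p] for p at fixed l: position l now carries p i. A
    sum over all components thus becomes the component p i evaluated on exchanged permutations. *)
Lemma sum_perm_all (F : 'S_n -> 'I_n -> R) i :
  \sum_(p : 'S_n) \sum_(m < n) F p m =
  \sum_(p : 'S_n) \sum_(l < n) F (tperm i l * p)%g (p i).
Proof.
under eq_bigr => p _ do rewrite (reindex_inj (@perm_inj _ p)).
rewrite exchange_big [RHS]exchange_big; apply: eq_bigr => l _ /=.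
by rewrite -(sum_tpermM _ i l); apply: eq_bigr => p _; rewrite permM tpermR.
Qed.

Lemma sum_perm_at (H : 'I_n -> R) i :
  n%:R * \sum_(p : 'S_n) H (p i) = n`!%:R * \sum_(m < n) H m.
Proof.
rewrite -sum_perm_cst (sum_perm_all (fun _ => H) i) big_distrr.
by apply: eq_bigr => p _ /=; rewrite sumr_const card_ord mulr_natl.
Qed.

Lemma sum_perm_reorder p (H : 'I_n -> R) : \sum_(l < n) H (p l) = \sum_(m < n) H m.
Proof. by rewrite [RHS](reindex_inj (@perm_inj _ p)). Qed.

End PermutationSums.

(** * One epoch as a function of its permutation, and the effect of a transposition *)

Section EpochTrajectory.
Context (R : realType) (n d : nat).
Variables (f : 'I_n -> 'rV[R]_d -> R) (e : R) (y : 'rV[R]_d)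
  (x : 'S_n -> nat -> 'rV[R]_d).
Hypotheses (x_start : forall p, x p 0%N = y)
  (x_step : forall p (i : 'I_n), x p i.+1 = x p i - e *: grad (f (p i)) (x p i)).

Lemma epoch_prefix (p q : 'S_n) k : (k <= n)%N ->
  (forall j : 'I_n, (j < k)%N -> p j = q j) -> x p k = x q k.
Proof.
elim: k => [|k IH] kn pq; first by rewrite !x_start.
have xk : x p k = x q k by apply: IH => [|j jk]; [exact: ltnW|apply: pq; exact: ltnW].
by rewrite (x_step p (Ordinal kn)) (x_step q (Ordinal kn)) pq//= xk.
Qed.

Lemma swap_later (p : 'S_n) (i l : 'I_n) k : (k <= i)%N -> (k <= l)%N ->
  x (tperm i l * p)%g k = x p k.
Proof.
move=> ki kl; apply: epoch_prefix => [|j jk]; first by rewrite (leq_trans ki)// ltnW.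
by rewrite permM tpermD// eq_sym neq_ltn; 
  [rewrite (leq_trans jk ki)|rewrite (leq_trans jk kl)].
Qed.

Hypothesis (e0 : 0 <= e).
Variable (L : 'I_n -> R).
Hypotheses (Lpos : forall i, 0 < L i) (eL : forall i, e * L i <= 1)
  (fdiff : forall i z, differentiable (f i) z)
  (fconv : forall i, convex_function [set: 'rV[R]_d] (f i))
  (fsmooth : forall i, smooth (L i) (f i)).

(** The two runs agree up to step l, where they apply different components at the same point and
    separate by e times [dg]. Steps l + 1 to i - 1 use equal components and are nonexpansive. *)
Lemma swap_earlier (p : 'S_n) (i l : 'I_n) : (l < i)%N ->
  let dx := x (tperm i l * p)%g i - x p i in
  let dg := grad (f (p i)) (x p l) - grad (f (p l)) (x p l) in
  dot dx dx <= e ^+ 2 * dot dg dg.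
Proof.
move=> li /=; set q := (tperm i l * p)%g; set dg := _ - grad _ _.
have H k : (l < k)%N -> (k <= i)%N ->
    dot (x q k - x p k) (x q k - x p k) <= e ^+ 2 * dot dg dg.
  elim: k => // k IH; rewrite ltnS leq_eqVlt => /orP[/eqP<- _|lk ki].
    rewrite !x_step swap_later ?(ltnW li)// permM tpermR.
    have -> : x p l - e *: grad (f (p i)) (x p l)
        - (x p l - e *: grad (f (p l)) (x p l)) = - (e *: dg).
      by rewrite opprB addrC addrA subrK /dg scalerBr opprB.
    by rewrite dotNl dotNr opprK dotZl dotZr mulrA expr2.
  have kn : (k < n)%N := ltn_trans ki (ltn_ord i).
  have qp : q (Ordinal kn) = p (Ordinal kn).
    by rewrite permM tpermD// -val_eqE/= ?(gtn_eqF ki)// ltn_eqF.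
  rewrite (x_step q (Ordinal kn)) (x_step p (Ordinal kn)) qp /=.
  apply: le_trans (IH lk (ltnW ki)).
  exact: (gradient_step_nonexpansive (Lpos _) (fdiff _) (fconv _) (fsmooth _)).
exact: H.
Qed.

End EpochTrajectory.

Lemma le_telescope (R : realType) n (F : nat -> R) (c : 'I_n -> R) :
  (forall i : 'I_n, F i.+1 <= F i - c i) -> F n <= F 0%N - \sum_(i < n) c i.
Proof.
move=> Fc; rewrite -lerBlDl -telescope_sumr// big_mkord -sumrN.
by apply: ler_sum => i _; rewrite lerBlDl.
Qed.

(* [k * D + k * (k - 1) * C] is the mean squared norm of a sum of k vectors drawn
   without replacement from N + 1 vectors after removing one of them; D and C are
   the diagonal and off-diagonal means. For N = 1, C is [_ / 0 = 0]. *)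
Lemma two_level_bound (R : realType) (k : nat) (N X E : R) :
  k%:R <= N -> 0 <= E -> E <= X ->
  k%:R * ((X - E) / N + (k%:R - 1) * ((E - (X - E)) / (N * (N - 1)))) <= X.
Proof.
case: k => [|[|k]] kN E_ge0 E_le; first by rewrite mul0r (le_trans E_ge0).
  rewrite mul1r subrr mul0r addr0 ler_pdivrMr ?(lt_le_trans ltr01 kN)//.
  have := ler_wpM2l (le_trans E_ge0 E_le) kN; lra.
have K2 : 2 <= k.+2%:R :> R by rewrite ler_nat.
move: k.+2%:R kN K2 => {}k kN k2.
(* Over the common denominator, the coefficients of X - E and of E are both at most 1, and these two
   add up to X. *)
have -> : k * ((X - E) / N + (k - 1) * ((E - (X - E)) / (N * (N - 1)))) =
    (k * (N - k) * (X - E) + k * (k - 1) * E) / (N * (N - 1)).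
  by field; rewrite !gt_eqF//; lra.
rewrite ler_pdivrMr ?mulr_gt0//; [|lra..].
have XE : 0 <= X - E by rewrite subr_ge0.
have h1 : k * (N - k) <= N * (N - 1) by apply: ler_pM; lra.
have h2 : k * (k - 1) <= N * (N - 1) by apply: ler_pM; lra.
have := ler_wpM2r XE h1; have := ler_wpM2r E_ge0 h2; lra.
Qed.

(** * Estimates for one epoch with stepsize e *)

Section EpochBounds.
Context (R : realType) (n d : nat).
Variables (f : 'I_n -> 'rV[R]_d -> R) (L : 'I_n -> R) (e : R)
  (xstar y : 'rV[R]_d) (x : 'S_n -> nat -> 'rV[R]_d).
Hypotheses (n0 : (0 < n)%N) (Lpos : forall i, 0 < L i)
  (fdiff : forall i z, differentiable (f i) z)
  (fconv : forall i, convex_function [set: 'rV[R]_d] (f i))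
  (fsmooth : forall i, smooth (L i) (f i))
  (grad_xstar : \sum_(i < n) grad (f i) xstar = 0)
  (e0 : 0 < e) (eL : forall i, 6 * e * L i <= 1)
  (x_start : forall p, x p 0%N = y)
  (x_step : forall p (i : 'I_n), x p i.+1 = x p i - e *: grad (f (p i)) (x p i)).

Let a i := grad (f i) xstar.
Let A i := dot (a i) (a i).
Let Atot := \sum_(i < n) A i.
Let Ltot := \sum_(i < n) L i.
Let b i z := bregman (f i) z xstar.
Let g i z := grad (f i) z - a i.
Let G i z := dot (g i z) (g i z).
(** Expectations over the permutation are kept as sums over 'S_n, so [W] takes the place of the
    total mass 1. *)
Let W : R := n`!%:R.
Let beta := \sum_(p : 'S_n) \sum_(i < n) b (p i) (x p i).
Let Gamma := \sum_(p : 'S_n) \sum_(i < n) G (p i) (x p i).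
Let dev p i l := x (tperm i l * p)%g i - x p i.

Let A_ge0 i : 0 <= A i. Proof. exact: dot_ge0. Qed.
Let G_ge0 i z : 0 <= G i z. Proof. exact: dot_ge0. Qed.
Let b_ge0 i z : 0 <= b i z. Proof. exact: bregman_ge0. Qed.
Let W_ge0 : 0 <= W. Proof. exact: ler0n. Qed.
Let Atot_ge0 : 0 <= Atot. Proof. exact: sumr_ge0. Qed.
Let A_le i : A i <= Atot.
Proof. by rewrite /Atot (bigD1 i)//= lerDl sumr_ge0. Qed.
Let e2_ge0 : 0 <= 4 * e ^+ 2. Proof. by rewrite mulr_ge0// sqr_ge0. Qed.
Let n_gt0 : 0 < n%:R :> R. Proof. by rewrite ltr0n. Qed.

(** Termwise, e G <= 2 e L b <= b / 3 because 6 e L <= 1. *)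
Lemma Gamma_le_beta : e * Gamma <= beta / 3.
Proof.
rewrite mulrC ler_pdivlMr// -mulrA /Gamma /beta mulr_suml; apply: ler_sum => p _.
rewrite mulr_suml; apply: ler_sum => i _.
have := grad_sub_le_bregman (Lpos (p i)) (fdiff (p i)) (fconv (p i)) (fsmooth (p i))
  (x p i) xstar.
rewrite -/(a (p i)) -/(g (p i) (x p i)) -/(G _ _) -/(b _ _) => H.
have : e * G (p i) (x p i) <= e * (2 * L (p i) * b (p i) (x p i)).
  exact: (ler_wpM2l (ltW e0) H).
have : (6 * e * L (p i)) * b (p i) (x p i) <= b (p i) (x p i) by rewrite ler_piMl.
lra.
Qed.

(** Splitting gradients as a + g and using |u + v|^2 <= 2 |u|^2 + 2 |v|^2 twice produces the factor
    4. The G terms keep the indicator because [sum_swap_dev] exchanges positions in them only when l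
    < i. *)
Lemma swap_dev (p : 'S_n) (i l : 'I_n) :
  dot (dev p i l) (dev p i l) <= 4 * e ^+ 2 * (A (p i) + A (p l) +
    (l < i)%N%:R * (G (p i) (x p l) + G (p l) (x p l))).
Proof.
case: ltnP => li; rewrite ?mul1r ?mul0r; last first.
  rewrite /dev (swap_later x_start x_step)// subrr dot0l.
  by rewrite mulr_ge0// addr0 addr_ge0.
have eL1 m : e * L m <= 1.
  by have := eL m; have := mulr_ge0 (ltW e0) (ltW (Lpos m)); lra.
have := swap_earlier x_start x_step (ltW e0) Lpos eL1 fdiff fconv fsmooth p li.
rewrite /= -/(dev p i l) => H; apply: le_trans H _.
rewrite (_ : 4 * e ^+ 2 = e ^+ 2 * 4); last by rewrite mulrC.
rewrite -mulrA ler_wpM2l ?sqr_ge0//.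
have -> : grad (f (p i)) (x p l) - grad (f (p l)) (x p l) =
    (a (p i) - a (p l)) + (g (p i) (x p l) - g (p l) (x p l)).
  by apply/rowP => j; rewrite !mxE; ring.
have := dotD_le (a (p i) - a (p l)) (g (p i) (x p l) - g (p l) (x p l)).
have := dotB_le (a (p i)) (a (p l)).
have := dotB_le (g (p i) (x p l)) (g (p l) (x p l)).
rewrite /A /G; lra.
Qed.

(** [G (p i) (x p l)] evaluates p i at a point where p l is due. For l < i, exchanging positions i
    and l leaves x p l unchanged and turns this into a term of [Gamma]; hence the factor 2. *)
Lemma sum_swap_dev (w : 'I_n -> R) (om : R) (i : 'I_n) :
  (forall m, 0 <= w m <= om) ->
  \sum_(p : 'S_n) \sum_(l < n) w (p i) * dot (dev p i l) (dev p i l) <=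
  4 * e ^+ 2 * (\sum_(p : 'S_n) \sum_(l < n) w (p i) * (A (p i) + A (p l))
                + 2 * om * Gamma).
Proof.
move=> wom; rewrite exchange_big [X in X + _]exchange_big/=.
rewrite /Gamma [X in 2 * om * X]exchange_big/= [2 * om * _]mulr_sumr -big_split.
rewrite mulr_sumr; apply: ler_sum => l _ /=.
have om0 : 0 <= om.
  by have /andP[] := wom i; exact: le_trans.
have -> : 2 * om * \sum_(p : 'S_n) G (p l) (x p l) =
   \sum_(p : 'S_n) om * G (p l) (x p l) + \sum_(p : 'S_n) om * G (p l) (x p l).
  by rewrite -!mulr_sumr; ring.
have swapG : \sum_(p : 'S_n) (l < i)%N%:R * (om * G (p i) (x p l)) <=
    \sum_(p : 'S_n) om * G (p l) (x p l).
  case: ltnP => li; last first.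
    by under eq_bigr do rewrite mul0r; rewrite big1// sumr_ge0// => p _; rewrite mulr_ge0.
  rewrite -(sum_tpermM _ i l) le_eqVlt; apply/orP; left; apply/eqP.
  apply: eq_bigr => p _.
  by rewrite mul1r permM tpermL (swap_later x_start x_step)// ltnW.
apply: le_trans (_ : \sum_(p : 'S_n) 4 * e ^+ 2 * (w (p i) * (A (p i) + A (p l))
    + (l < i)%N%:R * (om * G (p i) (x p l)) + om * G (p l) (x p l)) <= _); last first.
  rewrite -mulr_sumr !big_split/= (ler_wpM2l e2_ge0)//.
  by rewrite -!addrA lerD2l lerD2r.
apply: ler_sum => p _; have /andP[w0 wle] := wom (p i).
apply: le_trans (ler_wpM2l w0 (swap_dev p i l)) _.
rewrite mulrCA (ler_wpM2l e2_ge0)// mulrDr -addrA lerD2l.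
have := ler_wpM2r (G_ge0 (p i) (x p l)) wle.
have := ler_wpM2r (G_ge0 (p l) (x p l)) wle.
have := mulr_ge0 om0 (G_ge0 (p l) (x p l)).
by case: (l < i)%N; rewrite ?(mul1r, mul0r); lra.
Qed.

Let sum_A : \sum_(p : 'S_n) \sum_(l < n) A (p l) = W * Atot.
Proof. by under eq_bigr do rewrite sum_perm_reorder; rewrite sum_perm_cst. Qed.

Let sum_A_at i : \sum_(p : 'S_n) \sum_(l < n) A (p i) = W * Atot.
Proof.
rewrite -(sum_perm_at _ i) mulr_sumr; apply: eq_bigr => p _.
by rewrite sumr_const card_ord mulr_natl.
Qed.

(* The sum over m of [dot (a m) z] vanishes, so after exchanging positions only the
   deviations [dev] remain. *)
Lemma cross_term : - (6 * e * W * Atot + 2 * e * Gamma) <=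
  2 * \sum_(p : 'S_n) \sum_(i < n) dot (a (p i)) (x p i - xstar).
Proof.
rewrite [in leRHS]exchange_big [leRHS]mulr_sumr/=.
have -> : - (6 * e * W * Atot + 2 * e * Gamma) =
    \sum_(i < n) - (6 * e * W * Atot + 2 * e * Gamma) / n%:R.
  by rewrite sumr_const card_ord -[RHS]mulr_natr divfK ?gt_eqF.
apply: ler_sum => i _; rewrite ler_pdivrMr//.
have E : 0 = n%:R * (\sum_(p : 'S_n) dot (a (p i)) (x p i - xstar)) +
    \sum_(p : 'S_n) \sum_(l < n) dot (a (p i)) (dev p i l).
  rewrite mulr_sumr -big_split/=.
  transitivity (\sum_(p : 'S_n) \sum_(m < n) dot (a m) (x p i - xstar)).
    by rewrite big1// => p _; rewrite -dot_suml grad_xstar dot0l.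
  rewrite (sum_perm_all (fun p m => dot (a m) (x p i - xstar)) i).
  apply: eq_bigr => p _.
  have -> : n%:R * dot (a (p i)) (x p i - xstar) = \sum_(l < n) dot (a (p i)) (x p i - xstar).
    by rewrite sumr_const card_ord mulr_natl.
  rewrite -big_split/=.
  by apply: eq_bigr => l _; rewrite -dotDr /dev [in RHS]addrC addrA subrK.
(* The weight [4 * e] reduces the factor [4 * e ^+ 2] of [sum_swap_dev] to e. The noise coefficient
   6 e is 4 e from here plus 2 e from the deviations. *)
have Y : 2 * \sum_(p : 'S_n) \sum_(l < n) dot (a (p i)) (dev p i l) <=
    4 * e * (W * Atot) + (4 * e)^-1 *
    \sum_(p : 'S_n) \sum_(l < n) 1 * dot (dev p i l) (dev p i l).
  rewrite -(sum_A_at i) [2 * _]mulr_sumr [4 * e * _]mulr_sumr.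
  rewrite [_^-1 * _]mulr_sumr -big_split; apply: ler_sum => p _.
  rewrite [2 * _]mulr_sumr [4 * e * _]mulr_sumr [_^-1 * _]mulr_sumr -big_split.
  apply: ler_sum => l _ /=.
  by rewrite mul1r; apply: dot_youngr; rewrite mulr_gt0.
have w1 (m : 'I_n) : 0 <= (1 : R) <= 1 by rewrite ler01 lexx.
have S := sum_swap_dev i w1.
have e4 : 0 <= (4 * e)^-1 by rewrite invr_ge0 mulr_ge0// ltW.
have {}S := ler_wpM2l e4 S.
have X : \sum_(p : 'S_n) \sum_(l < n) 1 * (A (p i) + A (p l)) = 2 * (W * Atot).
  rewrite [LHS](_ : _ = \sum_(p : 'S_n) \sum_(l < n) A (p i) +
      \sum_(p : 'S_n) \sum_(l < n) A (p l)).
    by rewrite sum_A sum_A_at; ring.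
  rewrite -big_split; apply: eq_bigr => p _; rewrite -big_split.
  by apply: eq_bigr => l _; rewrite mul1r.
rewrite X in S.
have S' : (4 * e)^-1 * (4 * e ^+ 2 * (2 * (W * Atot) + 2 * 1 * Gamma)) =
   e * (2 * (W * Atot) + 2 * Gamma) by field; rewrite gt_eqF.
rewrite S' in S; clear w1; lra.
Qed.

Let D0 := dot (y - xstar) (y - xstar).
Let D1 := \sum_(p : 'S_n) dot (x p n - xstar) (x p n - xstar).

(** In the expanded square, <grad, x - xstar> equals b + <a, x - xstar> plus the divergence of xstar
    relative to x, which is nonnegative and dropped. After [cross_term], 4 e^2 [Gamma] remains and
    costs 4 / 3 e [beta], whence - 2 + 4 / 3 = - 2 / 3. *)
Lemma epoch_descent_variance :
  D1 <= W * D0 - 2 / 3 * e * beta + 8 * e ^+ 2 * W * Atot.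
Proof.
have step : D1 <= \sum_(p : 'S_n) (D0 - \sum_(i < n) (2 * e * b (p i) (x p i)
    + 2 * e * dot (a (p i)) (x p i - xstar) - 2 * e ^+ 2 * A (p i)
    - 2 * e ^+ 2 * G (p i) (x p i))).
  apply: ler_sum => p _.
  rewrite /D0 -(x_start p).
  apply: (le_telescope (F := fun k => dot (x p k - xstar) (x p k - xstar))) => i.
  have := bregman_ge0 (fdiff (p i)) (fconv (p i)) xstar (x p i).
  have := dotD_le (a (p i)) (g (p i) (x p i)).
  rewrite x_step /b /bregman -/(a _) -/(A _) -/(G _ _).
  have -> : a (p i) + g (p i) (x p i) = grad (f (p i)) (x p i) by rewrite addrC subrK.
  have -> : xstar - x p i = - (x p i - xstar) by rewrite opprB.
  rewrite [x p i - _ *: _ - _]addrAC dotNr.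
  move: (x p i - xstar) (grad (f (p i)) (x p i)) => v u.
  rewrite !dotE (dotC v u) => /(ler_wpM2l (sqr_ge0 e)) H1 /(ler_wpM2l (ltW e0)) H2.
  lra.
apply: le_trans step _.
rewrite big_split/= sum_perm_cst sumrN -/W.
under eq_bigr do rewrite !(sumrB, big_split)/= -!mulr_sumr.
rewrite !(sumrB, big_split)/= -!mulr_sumr -/beta -/Gamma sum_A.
have := cross_term; have := Gamma_le_beta.
set C := \sum_(p : 'S_n) _ => /(ler_wpM2l (ltW e0)) H1 /(ler_wpM2l (ltW e0)) H2.
lra.
Qed.

Let gap := \sum_(p : 'S_n) \sum_(i < n) (objective f (x p i) - objective f xstar).

Lemma objective_gap z : n%:R * (objective f z - objective f xstar) = \sum_(m < n) b m z.
Proof.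
rewrite mulrBr /objective !mulVKf ?gt_eqF// /b /bregman !sumrB -dot_suml.
by rewrite grad_xstar dot0l subr0.
Qed.

(** [sum_perm_all] turns the sum of all b m at x p i into b (p i) on the exchanged run, and
    [bregman_shift] returns to x p i at the price of L |dev|^2. The bound X on the weighted noise
    stays free because the two final estimates choose it differently. Here 22 / 9 = 2 + 4 / 9, the
    last term coming from [Gamma]. *)
Lemma gap_le_beta (X : R) :
  (forall i : 'I_n, \sum_(p : 'S_n) \sum_(l < n) L (p i) * (A (p i) + A (p l)) <= X) ->
  e * gap <= 22 / 9 * e * beta + 4 * e ^+ 3 * X.
Proof.
move=> hX.
have Lom m : 0 <= L m <= (6 * e)^-1.
  rewrite ltW// -div1r ler_pdivlMr ?mulr_gt0//.
  by have := eL m; rewrite mulrC.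
have swap_i (i : 'I_n) :
    \sum_(p : 'S_n) n%:R * (objective f (x p i) - objective f xstar) <=
    \sum_(p : 'S_n) n%:R * (2 * b (p i) (x p i)) +
    4 * e ^+ 2 * (X + 2 * (6 * e)^-1 * Gamma).
  under eq_bigr do rewrite objective_gap.
  rewrite (sum_perm_all (fun p m => b m (x p i)) i).
  apply: le_trans (_ : \sum_(p : 'S_n) n%:R * (2 * b (p i) (x p i)) +
    \sum_(p : 'S_n) \sum_(l < n) L (p i) * dot (dev p i l) (dev p i l) <= _).
    rewrite -big_split; apply: ler_sum => p _ /=.
    have -> : n%:R * (2 * b (p i) (x p i)) = \sum_(l < n) 2 * b (p i) (x p i).
      by rewrite sumr_const card_ord mulr_natl.
    rewrite -big_split; apply: ler_sum => l _ /=.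
    exact: (bregman_shift (Lpos _) (fdiff _) (fconv _) (fsmooth _)).
  rewrite lerD2l; apply: le_trans (sum_swap_dev i Lom) _.
  by rewrite (ler_wpM2l e2_ge0)// lerD2r.
have ngap : n%:R * gap <= n%:R * (2 * beta + 4 * e ^+ 2 * (X + 2 * (6 * e)^-1 * Gamma)).
  rewrite /gap /beta exchange_big [X in 2 * X]exchange_big/=.
  have -> (c : R) : n%:R * (2 * (\sum_(i < n) \sum_(p : 'S_n) b (p i) (x p i)) + c) =
      \sum_(i < n) (\sum_(p : 'S_n) n%:R * (2 * b (p i) (x p i)) + c).
    rewrite big_split/= sumr_const card_ord mulrDr -[c *+ n]mulr_natl; congr (_ + _).
    rewrite mulrA mulr_sumr; apply: eq_bigr => i _.
    by rewrite mulr_sumr; apply: eq_bigr => p _; rewrite mulrA.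
  rewrite mulr_sumr; apply: ler_sum => i _.
  by rewrite mulr_sumr; exact: swap_i.
have {ngap} := ngap; rewrite ler_pM2l// => /(ler_wpM2l (ltW e0)).
have -> : e * (2 * beta + 4 * e ^+ 2 * (X + 2 * (6 * e)^-1 * Gamma)) =
    2 * e * beta + 4 * e ^+ 3 * X + 4 / 3 * (e * (e * Gamma)).
  by field; rewrite gt_eqF.
have := ler_wpM2l (ltW e0) Gamma_le_beta.
lra.
Qed.

(** Bounding L by 1 / (6 e) in the weighted noise trades it for one power of e. The constants fit
    since 8 + 2 / 9 <= 51 / 6 and 22 / 54 <= 2 / 3. *)
Lemma epoch_variance : D1 + e * gap / 6 <= W * D0 + 51 / 6 * W * e ^+ 2 * Atot.
Proof.
have gapX := @gap_le_beta (2 * (6 * e)^-1 * W * Atot).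
have {}gapX : e * gap <= 22 / 9 * e * beta + 4 / 3 * e ^+ 2 * W * Atot.
  apply: le_trans (gapX _) _ => [i|]; last first.
    by rewrite lerD2l le_eqVlt; apply/orP; left; apply/eqP; field; rewrite gt_eqF.
  have -> : 2 * (6 * e)^-1 * W * Atot = (6 * e)^-1 * (W * Atot + W * Atot) by ring.
  rewrite -{1}(sum_A_at i) -sum_A -big_split mulr_sumr; apply: ler_sum => p _ /=.
  rewrite -big_split mulr_sumr; apply: ler_sum => l _ /=.
  rewrite ler_wpM2r ?addr_ge0// -div1r ler_pdivlMr ?mulr_gt0//.
  by have := eL (p i); rewrite mulrC.
have eb : 0 <= e * beta.
  by rewrite mulr_ge0 ?(ltW e0)//; apply: sumr_ge0 => p _; apply: sumr_ge0.
have eA : 0 <= e ^+ 2 * W * Atot.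
  by rewrite mulr_ge0 ?Atot_ge0// mulr_ge0 ?sqr_ge0.
have := epoch_descent_variance; lra.
Qed.

(** The shadow trajectory of p is [xstar - e *: S p k]. *)
Let S (p : 'S_n) k := \sum_(j < n | (j < k)%N) a (p j).

Let S_0 p : S p 0 = 0. Proof. exact: big_pred0. Qed.

Let S_n p : S p n = 0.
Proof.
rewrite /S (eq_bigl xpredT) => [|j]; last by rewrite ltn_ord.
by rewrite -[RHS]grad_xstar [RHS](reindex_inj (@perm_inj _ p)).
Qed.

Let S_step p (i : 'I_n) : S p i.+1 = S p i + a (p i).
Proof.
rewrite /S (bigD1 i) ?ltnS//= addrC; congr (_ + _).
by apply: eq_bigl => j; rewrite ltnS ltn_neqAle andbC.
Qed.

(* Conditionally on [p i], the prefix sum samples the vectors [a m], m <> p i, without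
   replacement; their total is [- a (p i)]. *)
Lemma prefix_sum_le (i : 'I_n) :
  n%:R * \sum_(p : 'S_n) L (p i) * dot (S p i) (S p i) <= W * Ltot * Atot.
Proof.
rewrite /W -mulrA mulr_suml -(sum_perm_at (fun m => L m * Atot) i).
rewrite ler_wpM2l ?ler0n//; set X := \sum_(p : 'S_n) L (p i) * Atot.
(* [u j l] depends only on which of i, j, l coincide, so the zero row sums and the trace X determine
   all its values from E. They are stated multiplied by N or N - 1 to avoid division. *)
pose u j l := \sum_(p : 'S_n) L (p i) * dot (a (p j)) (a (p l)).
have L0 m : 0 <= L m := ltW (Lpos m).
pose E := u i i; pose N : R := n%:R - 1.
have E_ge0 : 0 <= E by apply: sumr_ge0 => p _; rewrite mulr_ge0 ?dot_ge0.
have E_le : E <= X by apply: ler_sum => p _; apply: (ler_wpM2l (L0 _)); exact: A_le.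
have uC j l : u j l = u l j by apply: eq_bigr => p _; rewrite dotC.
have u_swap j l m : i != l -> i != m -> j != l -> j != m -> u j l = u j m.
  move=> il im jl jm; rewrite /u -(sum_tpermM _ l m); apply: eq_bigr => p _.
  by rewrite !permM tpermL !tpermD// eq_sym.
have u_diag j l : i != j -> i != l -> u j j = u l l.
  move=> ij il; rewrite /u -(sum_tpermM _ j l); apply: eq_bigr => p _.
  by rewrite !permM tpermL tpermD// eq_sym.
have sum_u j : \sum_(l < n) u j l = 0.
  rewrite exchange_big big1// => p _; rewrite -mulr_sumr -dot_sumr.
  have -> : \sum_(l < n) a (p l) = S p n.
    by apply: eq_bigl => l; rewrite ltn_ord.
  by rewrite S_n dot0r mulr0.
have sum_diag : \sum_(l < n) u l l = X.
  rewrite exchange_big; apply: eq_bigr => p _; rewrite -mulr_sumr; congr (_ * _).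
  exact: (sum_perm_reorder p A).
have sum_except (c : R) : \sum_(l < n | l != i) c = N * c.
  rewrite sumr_const; have := cardC1 i; rewrite card_ord => ->.
  by rewrite -mulr_natl -subn1 natrB.
have diagE j : i != j -> N * u j j = X - E.
  move=> ij; rewrite -sum_diag [in RHS](bigD1 i)//= [u i i + _]addrC -/E addrK -sum_except.
  by apply: eq_bigr => l li; apply: u_diag => //; rewrite eq_sym.
have crossE l : i != l -> N * u i l = - E.
  move=> il; apply/eqP; rewrite -addr_eq0 -(sum_u i) (bigD1 i)//= addrC -sum_except.
  apply/eqP; congr (_ + _); apply: eq_bigr => m mi.
  by apply: u_swap; rewrite // eq_sym.
have offE j l : i != j -> i != l -> j != l -> N * ((N - 1) * u j l) = E - (X - E).
  move=> ij il jl.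
  have K : \sum_(m < n | m != i) (u j m - u j l) = u j j - u j l.
    rewrite (bigD1 j) 1?eq_sym//= big1 ?addr0// => m /andP[mi mj].
    by rewrite (u_swap j m l) ?subrr// 1?eq_sym.
  have J : u j i + \sum_(m < n | m != i) u j m = 0.
    by rewrite -[RHS](sum_u j) [RHS](bigD1 i).
  have {K} : (N - 1) * u j l = - u i j - u j j.
    by move: K J; rewrite sumrB sum_except (uC i j); lra.
  move=> ->; rewrite mulrBr mulrN crossE// diagE//; lra.
pose D := (X - E) / N; pose C := (E - (X - E)) / (N * (N - 1)).
have kN : (i : nat)%:R <= N.
  by rewrite /N lerBrDr natr1 ler_nat.
have T : \sum_(p : 'S_n) L (p i) * dot (S p i) (S p i) =
    i%:R * (D + (i%:R - 1) * C).
  transitivity (\sum_(j < n | (j < i)%N) \sum_(l < n | (l < i)%N) u j l).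
    under eq_bigr => p _ do rewrite dot_suml mulr_sumr.
    rewrite exchange_big/=; apply: eq_bigr => j _.
    under eq_bigr => p _ do rewrite dot_sumr mulr_sumr.
    by rewrite exchange_big.
  have sum_prefix (c : R) : \sum_(j < n | (j < i)%N) c = i%:R * c.
    by rewrite -(big_ord_widen _ (fun=> c) (ltnW (ltn_ord i))) sumr_const card_ord mulr_natl.
  have -> : \sum_(j < n | (j < i)%N) \sum_(l < n | (l < i)%N) u j l =
     \sum_(j < n | (j < i)%N) (D + (i%:R - 1) * C).
    apply: eq_bigr => j ji.
    have ij : i != j by rewrite -val_eqE/= gtn_eqF.
    have N0 : 0 < N by apply: lt_le_trans kN; rewrite ltr0n (leq_trans _ ji).
    rewrite (bigD1 j)//=; congr (_ + _).
      by apply: (mulfI (lt0r_neq0 N0)); rewrite diagE// mulrC divfK// gt_eqF.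
    transitivity (\sum_(l < n | (l < i)%N && (l != j)) C).
      apply: eq_bigr => l /andP[li lj].
      have il : i != l by rewrite -val_eqE/= gtn_eqF.
      (* The distinct indices l and j both lie below i, so i is at least 2. *)
      have N1 : 0 < N - 1.
        rewrite subr_gt0; apply: lt_le_trans kN; rewrite ltr1n.
        move: lj; rewrite -val_eqE/= neq_ltn => /orP[] lt.
          exact: leq_ltn_trans (leq_ltn_trans (leq0n l) lt) ji.
        exact: leq_ltn_trans (leq_ltn_trans (leq0n j) lt) li.
      have NN : N * (N - 1) != 0 by rewrite mulf_neq0// gt_eqF.
      by apply: (mulfI NN); rewrite -mulrA offE 1?(eq_sym j)// mulrC divfK.
    have := sum_prefix C; rewrite (bigD1 j)//= mulrBl mul1r => <-.
    by rewrite [C + _]addrC addrK.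
  exact: sum_prefix.
rewrite T; exact: two_level_bound.
Qed.

(** With s the shadow point, a step changes x - s by - e (grad - a), and <grad - a, x - s> is b at
    x, plus the divergence of s relative to x, minus b at s. The middle term is nonnegative, and b
    at s is at most L e^2 |S|^2 / 2, whence the e^3 term. *)
Lemma epoch_descent_shuffling :
  D1 <= W * D0 - 5 / 3 * e * beta + e ^+ 3 * (W * Ltot * Atot).
Proof.
have step : D1 <= \sum_(p : 'S_n) (D0 - \sum_(i < n) (2 * e * b (p i) (x p i)
    - e ^+ 3 * (L (p i) * dot (S p i) (S p i)) - e ^+ 2 * G (p i) (x p i))).
  apply: ler_sum => p _.
  pose F k := dot (x p k - (xstar - e *: S p k)) (x p k - (xstar - e *: S p k)).
  have -> : dot (x p n - xstar) (x p n - xstar) = F n.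
    by rewrite /F S_n scaler0 subr0.
  have -> : D0 = F 0 by rewrite /F S_0 scaler0 subr0 x_start.
  apply: le_telescope => i; rewrite /F x_step S_step.
  have := bregman_ge0 (fdiff (p i)) (fconv (p i)) (xstar - e *: S p i) (x p i).
  have := bregman_le (Lpos (p i)) (fdiff (p i)) (fsmooth (p i)) (xstar - e *: S p i) xstar.
  rewrite /b /bregman -/(a _) -/(A _).
  have -> : xstar - e *: S p i - xstar = - (e *: S p i) by rewrite addrAC subrr add0r.
  have -> : x p i - xstar = (x p i - (xstar - e *: S p i)) - e *: S p i.
    by apply/rowP => j; rewrite !mxE; ring.
  have -> : x p i - e *: grad (f (p i)) (x p i) - (xstar - e *: (S p i + a (p i))) =
      (x p i - (xstar - e *: S p i)) - e *: g (p i) (x p i).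
    by apply/rowP => j; rewrite !mxE; ring.
  have -> : xstar - e *: S p i - x p i = - (x p i - (xstar - e *: S p i)) by rewrite opprB.
  rewrite /G /g; move: (x p i - (xstar - e *: S p i)) => v.
  move: (f (p i) (xstar - e *: S p i)) => fs; move: (S p i) (a (p i)) => s u.
  move: (grad (f (p i)) (x p i)) => w.
  rewrite !dotE (dotC v w) (dotC v u) (dotC u w).
  move=> /(ler_wpM2l (ltW e0)) H1 /(ler_wpM2l (ltW e0)) H2.
  lra.
apply: le_trans step _.
rewrite big_split/= sum_perm_cst sumrN -/W.
under eq_bigr do rewrite !(sumrB, big_split)/= -!mulr_sumr.
rewrite !(sumrB, big_split)/= -!mulr_sumr -/beta -/Gamma.
have SQ : \sum_(p : 'S_n) \sum_(i < n) L (p i) * dot (S p i) (S p i) <= W * Ltot * Atot.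
  rewrite exchange_big/= -(ler_pM2l n_gt0) mulr_sumr.
  have -> : n%:R * (W * Ltot * Atot) = \sum_(i < n) W * Ltot * Atot.
    by rewrite sumr_const card_ord mulr_natl.
  by apply: ler_sum => i _; exact: prefix_sum_le.
have := ler_wpM2l (exprn_ge0 3 (ltW e0)) SQ.
have := ler_wpM2l (ltW e0) Gamma_le_beta.
lra.
Qed.

(** Bounding A by [Atot] before averaging L (p i) keeps the mean of L instead of its maximum. The
    constants fit since 1 + 8 / 6 <= 51 / 6 and 22 / 54 <= 5 / 3. *)
Lemma epoch_shuffling : D1 + e * gap / 6 <= W * D0 + 51 / 6 * W * e ^+ 3 * Ltot * Atot.
Proof.
have gapX : e * gap <= 22 / 9 * e * beta + 4 * e ^+ 3 * (2 * (W * Ltot * Atot)).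
  apply: gap_le_beta => i.
  apply: le_trans (_ : \sum_(p : 'S_n) n%:R * (L (p i) * (2 * Atot)) <= _).
    apply: ler_sum => p _; rewrite mulr_natl -[X in _ *+ X](card_ord n) -sumr_const.
    apply: ler_sum => l _; rewrite ler_wpM2l ?(ltW (Lpos _))//.
    by have := A_le (p i); have := A_le (p l); lra.
  rewrite -mulr_sumr (sum_perm_at (fun m => L m * (2 * Atot)) i) -mulr_suml.
  by rewrite le_eqVlt; apply/orP; left; apply/eqP; rewrite -/W -/Ltot; ring.
have eb : 0 <= e * beta.
  by rewrite mulr_ge0 ?(ltW e0)//; apply: sumr_ge0 => p _; apply: sumr_ge0.
have eA : 0 <= e ^+ 3 * W * Ltot * Atot.
  rewrite mulr_ge0 ?Atot_ge0// mulr_ge0//; last by apply: sumr_ge0 => i _; exact: ltW.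
  by rewrite mulr_ge0// exprn_ge0// ltW.
have := epoch_descent_shuffling; lra.
Qed.

End EpochBounds.

(** The tangent at the weighted mean lies below h, and its linear terms average to 0. *)
Lemma jensen_sum (R : realType) d (h : 'rV[R]_d -> R) (I : finType)
    (w : I -> R) (z : I -> 'rV[R]_d) :
  (forall y, differentiable h y) -> convex_function [set: 'rV[R]_d] h ->
  (forall i, 0 <= w i) -> \sum_i w i = 1 ->
  h (\sum_i w i *: z i) <= \sum_i w i * h (z i).
Proof.
move=> dh ch w0 w1; set m := \sum_i w i *: z i.
have -> : h m = \sum_i w i * (h m + dot (grad h m) (z i - m)).
  under eq_bigr => i _ do rewrite mulrDr -dotZr scalerBr.
  rewrite big_split/= -mulr_suml w1 mul1r -dot_sumr sumrB -scaler_suml w1 scale1r.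
  by rewrite subrr dot0r addr0.
by apply: ler_sum => i _; rewrite ler_wpM2l//; exact: convex_first_order.
Qed.

(** * Dependence of a run on its permutations *)

Section RunsOfShufflingSGD.
Context (R : realType) (n d K : nat).
Variables (f : 'I_n -> 'rV[R]_d -> R) (eta : 'I_K -> R) (x0 : 'rV[R]_d).
Implicit Types (s : 'I_K -> 'S_n) (x : nat -> nat -> 'rV[R]_d).

Lemma sgd_within_epoch s s' x x' (k : 'I_K) i :
  shuffling_sgd f eta s x0 x -> shuffling_sgd f eta s' x0 x' ->
  s k = s' k -> x k 0%N = x' k 0%N -> (i <= n)%N -> x k i = x' k i.
Proof.
move=> [_ hx _] [_ hx' _] sk xk; elim: i => // i IH ni.
by rewrite (hx k (Ordinal ni)) (hx' k (Ordinal ni)) /= IH ?(ltnW ni)// sk.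
Qed.

Lemma sgd_epoch_start s s' x x' k :
  shuffling_sgd f eta s x0 x -> shuffling_sgd f eta s' x0 x' -> (k <= K)%N ->
  (forall j : 'I_K, (j < k)%N -> s j = s' j) -> x k 0%N = x' k 0%N.
Proof.
move=> hx hx'; elim: k => [|k IH] kK ss.
  by have [-> _ _] := hx; have [-> _ _] := hx'.
have [_ _ xS] := hx; have [_ _ xS'] := hx'.
rewrite (xS (Ordinal kK)) (xS' (Ordinal kK)).
apply: (sgd_within_epoch hx hx') => //; first exact: ss.
by apply: IH => [|j jk]; [exact: ltnW|apply: ss; exact: ltnW].
Qed.

(** Two solutions of [shuffling_sgd] may differ at unconstrained indices, but [xbar] reads only
    constrained ones. *)
Lemma sgd_ext s s' x x' : shuffling_sgd f eta s x0 x ->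
  shuffling_sgd f eta s' x0 x' -> s =1 s' -> xbar n eta x = xbar n eta x'.
Proof.
move=> hx hx' ss; apply: eq_bigr => k _; apply: eq_bigr => i _; congr (_ *: _).
apply: (sgd_within_epoch hx hx') => //; last exact: ltnW.
by apply: (sgd_epoch_start hx hx') => //; exact: ltnW.
Qed.

End RunsOfShufflingSGD.

(** * Redrawing the permutation of a single epoch *)

Section Resampling.
Context (R : realType) (n K : nat).

Definition resample (q : {ffun 'I_K -> 'S_n}) (k : 'I_K) (p : 'S_n) :
    {ffun 'I_K -> 'S_n} :=
  [ffun j => if j == k then p else q j].

(** Once p is replaced by p * q k, redrawing at fixed p multiplies q k on the left by p, which is a
    bijection in q. *)
Lemma sum_resample (F : {ffun 'I_K -> 'S_n} -> R) k :
  \sum_q \sum_(p : 'S_n) F (resample q k p) = n`!%:R * \sum_q F q.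
Proof.
rewrite -sum_perm_cst.
transitivity (\sum_q \sum_(p : 'S_n) F (resample q k (p * q k)%g)).
  by apply: eq_bigr => q _; rewrite [LHS](reindex_inj (mulIg (q k))).
rewrite exchange_big; apply: eq_bigr => p _ /=.
rewrite [RHS](reindex_inj (h := fun q => resample q k (p * q k)%g))// => q q' /ffunP E.
apply/ffunP => j; have := E j; rewrite !ffunE.
by case: eqVneq => // ->; exact: mulgI.
Qed.

End Resampling.

(** * From one epoch to the average over all runs, for a generic noise term c *)

Section AveragedBound.
Context (R : realType) (n d K : nat).
Variables (f : 'I_n -> 'rV[R]_d -> R) (eta : 'I_K -> R) (xstar x0 : 'rV[R]_d)
  (X : {ffun 'I_K -> 'S_n} -> nat -> nat -> 'rV[R]_d) (c : 'I_K -> R).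
Hypotheses (n0 : (0 < n)%N) (K0 : (0 < K)%N) (eta0 : forall k, 0 < eta k)
  (fdiff : forall i z, differentiable (f i) z)
  (fconv : forall i, convex_function [set: 'rV[R]_d] (f i))
  (X_sgd : forall q : {ffun 'I_K -> 'S_n}, shuffling_sgd f eta q x0 (X q))
  (epoch_bound : forall (k : 'I_K) (y : 'rV[R]_d) (x : 'S_n -> nat -> 'rV[R]_d),
    (forall p, x p 0%N = y) ->
    (forall p (i : 'I_n), x p i.+1 = x p i - eta k *: grad (f (p i)) (x p i)) ->
    \sum_(p : 'S_n) dot (x p n - xstar) (x p n - xstar) + eta k *
      (\sum_(p : 'S_n) \sum_(i < n) (objective f (x p i) - objective f xstar)) / 6
    <= n`!%:R * dot (y - xstar) (y - xstar) + 51 / 6 * n`!%:R * c k).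

Let M k := \sum_(q : {ffun 'I_K -> 'S_n}) dot (X q k 0%N - xstar) (X q k 0%N - xstar).
Let gap (q : {ffun 'I_K -> 'S_n}) (k : 'I_K) :=
  \sum_(i < n) (objective f (X q k i) - objective f xstar).
Let V : R := #|{ffun 'I_K -> 'S_n}|%:R.
Let D0 := dot (x0 - xstar) (x0 - xstar).
Let H := \sum_(k < K) eta k.

(** The start of epoch k does not depend on q k, so [epoch_bound] applies for each q to the redraws
    of that permutation; the resulting inequalities between M k and M k.+1 telescope. *)
Lemma sum_gap_le : \sum_q \sum_(k < K) eta k * gap q k <=
  V * (6 * D0 + 51 * \sum_(k < K) c k).
Proof.
have step (k : 'I_K) : M k.+1 <= M k - ((\sum_q eta k * gap q k) / 6 - 51 / 6 * V * c k).
  have W0 : 0 < n`!%:R :> R by rewrite ltr0n fact_gt0.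
  suff : n`!%:R * (M k.+1 + (\sum_q eta k * gap q k) / 6) <=
      n`!%:R * (M k + 51 / 6 * V * c k) by rewrite ler_pM2l//; lra.
  rewrite mulrDr mulrA {1}/M -(sum_resample _ k) -(sum_resample (fun q => eta k * gap q k) k).
  have -> : n`!%:R * (M k + 51 / 6 * V * c k) =
      \sum_q (n`!%:R * dot (X q k 0%N - xstar) (X q k 0%N - xstar) + 51 / 6 * n`!%:R * c k).
    rewrite big_split/= -mulr_sumr -/(M k) sumr_const -[X in _ = _ + X]mulr_natl -/V.
    by ring.
  rewrite mulr_suml -big_split; apply: ler_sum => q _ /=.
  rewrite -mulr_sumr.
  have -> : \sum_(p : 'S_n) dot (X (resample q k p) k.+1 0%N - xstar)
        (X (resample q k p) k.+1 0%N - xstar) =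
      \sum_(p : 'S_n) dot (X (resample q k p) k n - xstar) (X (resample q k p) k n - xstar).
    by apply: eq_bigr => p _; have [_ _ ->] := X_sgd (resample q k p).
  apply: (epoch_bound (x := fun p => X (resample q k p) k)) => p.
    apply: (sgd_epoch_start (X_sgd _) (X_sgd _) (ltnW (ltn_ord k))) => j jk.
    by rewrite ffunE -val_eqE/= ltn_eqF.
  by move=> i; have [_ -> _] := X_sgd (resample q k p); rewrite ffunE eqxx.
have M0 : M 0 = V * D0.
  rewrite /M /V mulr_natl -sumr_const; apply: eq_bigr => q _.
  by have [-> _ _] := X_sgd q.
have : 0 <= M K by apply: sumr_ge0 => q _; exact: dot_ge0.
have := le_telescope step; rewrite M0 sumrB -mulr_suml -mulr_sumr exchange_big/=.
lra.
Qed.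

Lemma sum_objective_xbar_le :
  \sum_q (objective f (xbar n eta (X q)) - objective f xstar) <=
  V * ((6 * D0 + 51 * \sum_(k < K) c k) / (n%:R * H)).
Proof.
have H0 : 0 < H.
  rewrite /H (bigD1 (Ordinal K0))//= ltr_pwDl//; apply: sumr_ge0 => k _; exact: ltW.
have nH0 : 0 < n%:R * H by rewrite mulr_gt0// ltr0n.
rewrite mulrA ler_pdivlMr// mulrC; apply: le_trans sum_gap_le.
rewrite mulr_sumr; apply: ler_sum => q _.
pose w (u : 'I_K * 'I_n) := eta u.1 / (n%:R * H).
have w_ge0 u : 0 <= w u by rewrite divr_ge0 ?ltW.
have w1 : \sum_u w u = 1.
  rewrite -(pair_bigA _ (fun k i => w (k, i)))/= /w/=.
  under eq_bigr do rewrite sumr_const card_ord.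
  by rewrite sumrMnl -mulr_suml -/H -[_ / _ *+ n]mulr_natl mulrA divff// gt_eqF//.
pose z (u : 'I_K * 'I_n) := X q u.1 u.2.
have xbarE : xbar n eta (X q) = \sum_u w u *: z u.
  by rewrite -(pair_bigA _ (fun k i => w (k, i) *: z (k, i))).
have obj : objective f (xbar n eta (X q)) <= \sum_u w u * objective f (z u).
  rewrite xbarE /objective.
  under [leRHS]eq_bigr do rewrite mulrCA mulr_sumr.
  rewrite -mulr_sumr ler_wpM2l ?invr_ge0// exchange_big/=; apply: ler_sum => i _.
  exact: jensen_sum.
have -> : \sum_(k < K) eta k * gap q k =
    n%:R * H * \sum_u w u * (objective f (z u) - objective f xstar).
  rewrite -(pair_bigA _ (fun k i => w (k, i) * (objective f (z (k, i)) - objective f xstar)))/=.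
  rewrite mulr_sumr; apply: eq_bigr => k _; rewrite /w/= -mulr_sumr mulrA.
  by rewrite [n%:R * H * _]mulrC divfK// gt_eqF.
rewrite ler_wpM2l ?(ltW nH0)//.
under eq_bigr do rewrite mulrBr.
by rewrite sumrB -mulr_suml w1 mul1r lerD2r.
Qed.

End AveragedBound.

(** * The expectation as a uniform average over tuples of permutations *)

Section RandomReshufflingExpectation.
Context (R : realType) (n K : nat).
Context (disp : measure_display) (T : measurableType disp) (P : probability T R).
Variables (s : 'I_K -> {RV P >-> 'S_n}) (hs : random_reshuffling s).
Implicit Types q : {ffun 'I_K -> 'S_n}.

Let A q : set T := \bigcap_k (s k @^-1` [set q k]).

Let AE q w : A q w <-> q = [ffun k => s k w].
Proof.
split=> [Aw|-> k _ /=]; last by rewrite ffunE.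
by apply/ffunP => k; rewrite ffunE; have /= -> := Aw k I.
Qed.

Let measurable_A q : measurable (A q).
Proof.
apply: fin_bigcap_measurable => // k _.
by rewrite -[_ @^-1` _]setTI; exact: (measurable_funP (s k)).
Qed.

Let V : R := #|{ffun 'I_K -> 'S_n}|%:R.

Lemma probability_reshuffling q : P (A q) = (V^-1)%:E.
Proof.
have [unif indep] := hs.
rewrite indep//; under eq_bigr do rewrite unif.
rewrite prodEFin prodr_const card_ord /V card_ffun card_ord card_Sn natrX exprVn.
by [].
Qed.

(** The event of drawing q has positive probability, so it is not empty. *)
Lemma reshuffling_attained q : exists w, forall k, s k w = q k.
Proof.
apply/not_existsP => Aq; have : P (A q) = 0%E.
  rewrite (_ : A q = set0) ?measure0//; apply/seteqP; split=> // w /AE E.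
  by apply: (Aq w) => k; rewrite E ffunE.
rewrite probability_reshuffling => -[] /eqP; rewrite invr_eq0 pnatr_eq0.
by apply/negP; rewrite -lt0n; apply/card_gt0P; exists q.
Qed.

(** The events A q partition the space and Y is constant on each, so Y is a finite nonnegative
    combination of indicators. *)
Lemma expectation_reshuffling (Y : T -> R) (F : {ffun 'I_K -> 'S_n} -> R) :
  (forall q, 0 <= F q) -> (forall w, Y w = F [ffun k => s k w]) ->
  ('E_P[Y] = (V^-1 * \sum_q F q)%R%:E)%E.
Proof.
move=> F0 YF; rewrite unlock.
transitivity (\int[P]_w (\sum_q (F q)%:E * (\1_(A q) w)%:E))%E.
  apply: eq_integral => w _.
  rewrite (bigD1 [ffun k => s k w])//= big1 => [|q qs].
    by rewrite adde0 YF indicE mem_set ?mule1//; apply/AE.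
  by rewrite indicE memNset ?mule0// => /AE E; rewrite E eqxx in qs.
rewrite ge0_integral_sum//; last 2 first.
- move=> q; apply: measurable_funeM; apply/measurable_realfun.measurable_EFinP.
  exact: measurable_realfun.measurable_indic.
- by move=> q w _; rewrite mule_ge0 ?lee_fin.
rewrite mulr_sumr -sumEFin; apply: eq_bigr => q _.
rewrite ge0_integralZl_EFin//; last first.
  apply/measurable_realfun.measurable_EFinP.
  exact: measurable_realfun.measurable_indic.
rewrite integral_indic// setIT mulrC EFinM; congr (_ * _)%E.
exact: probability_reshuffling.
Qed.

End RandomReshufflingExpectation.

Theorem theorem1 (R : realType) (n d K : nat)
  (hn : (0 < n)%N) (hd : (0 < d)%N) (hK : (0 < K)%N)
  (f : 'I_n -> 'rV[R]_d -> R)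
  (fdiff : forall i x, differentiable (f i) x)
  (xstar : 'rV[R]_d)
  (hxstar : (objective f xstar)%:E =
            ereal_inf [set (objective f x)%:E | x in [set: 'rV[R]_d]])
  (fconv : forall i, convex_function [set: 'rV[R]_d] (f i))
  (L : 'I_n -> R) (Lpos : forall i, 0 < L i)
  (fsmooth : forall i, smooth (L i) (f i))
  (eta : 'I_K -> R)
  (heta : forall k, 0 < eta k <= 1 / (6 * Lhat L))
  (disp : measure_display) (T : measurableType disp) (P : probability T R)
  (s : 'I_K -> {RV P >-> 'S_n}) (hs : random_reshuffling s)
  (x1 : 'rV[R]_d) (x : T -> nat -> nat -> 'rV[R]_d)
  (hx : forall w, shuffling_sgd f eta (fun k => s k w) x1 (x w)) :
  ('E_P[fun w => (objective f (xbar n eta (x w)) - objective f xstar)%R] <=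
   (6 * enorm (x1 - xstar) ^+ 2 / (n%:R * \sum_(k < K) eta k)
    + 51 * Num.min
        ((\sum_(k < K) eta k ^+ 2) / \sum_(k < K) eta k)
        ((\sum_(k < K) eta k ^+ 3 * n%:R * Lbar L) / \sum_(k < K) eta k)
      * sigma2 f xstar)%R%:E)%E.
Proof.
have Llhat i : L i <= Lhat L by exact: le_bigmax.
have Lhat0 : 0 < Lhat L := lt_le_trans (Lpos (Ordinal hn)) (Llhat _).
have eta0 k : 0 < eta k by have /andP[] := heta k.
have etaL k i : 6 * eta k * L i <= 1.
  have /andP[_] := heta k; rewrite ler_pdivlMr ?mulr_gt0// mulrA [eta k * 6]mulrC.
  by apply: le_trans; rewrite ler_wpM2l// mulr_ge0// ltW.
have n0 : 0 < n%:R :> R by rewrite ltr0n.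
have obj_min z : objective f xstar <= objective f z.
  by rewrite -lee_fin hxstar; apply: ereal_inf_lbound; exists z.
have grad0 : \sum_(i < n) grad (f i) xstar = 0.
  exact: grad_sum_minimizer hn Lpos fdiff fsmooth obj_min.
(* Every tuple is attained at some outcome, so a run for it can be picked from x itself. *)
have [X X_sgd] : {X : {ffun 'I_K -> 'S_n} -> nat -> nat -> 'rV[R]_d &
    forall q : {ffun 'I_K -> 'S_n}, shuffling_sgd f eta q x1 (X q)}.
  apply: (@choice _ _ (fun (q : {ffun 'I_K -> 'S_n}) y => shuffling_sgd f eta q x1 y)) => q.
  have [w wq] := reshuffling_attained hs q; exists (x w).
  by rewrite (_ : fun_of_fin q = fun k => s k w)//; apply/funext => k; rewrite wq.
rewrite (@expectation_reshuffling _ _ _ _ _ _ _ hs _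
    (fun q => objective f (xbar n eta (X q)) - objective f xstar)); first last.
- move=> w; congr (objective f _ - _).
  by apply: (sgd_ext (hx w) (X_sgd _)) => k; rewrite ffunE.
- by move=> q; rewrite subr_ge0.
have Atot : \sum_(i < n) dot (grad (f i) xstar) (grad (f i) xstar) = n%:R * sigma2 f xstar.
  by rewrite /sigma2 mulVKf ?gt_eqF//; apply: eq_bigr => i _; rewrite enorm_sqr.
have Ltot : \sum_(i < n) L i = n%:R * Lbar L by rewrite /Lbar mulVKf ?gt_eqF.
have H0 : 0 < \sum_(k < K) eta k.
  by rewrite (bigD1 (Ordinal hK))//= ltr_pwDl//; apply: sumr_ge0 => k _; exact: ltW.
have V0 : 0 < #|{ffun 'I_K -> 'S_n}|%:R :> R.
  by rewrite ltr0n; apply/card_gt0P; exists [ffun=> 1%g].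
rewrite lee_fin ler_pdivrMl// enorm_sqr.
have bound (c : 'I_K -> R) :=
  sum_objective_xbar_le (xstar := xstar) (c := c) hn hK eta0 fdiff fconv X_sgd.
(* Each branch is proved without the comparison, by inserting the noise term of the corresponding
   epoch estimate as c. *)
rewrite /Order.min; case: ifP => _.
  have {bound} := bound (fun k => eta k ^+ 2 * (n%:R * sigma2 f xstar)).
  move=> B; apply: (le_trans (B _)) => [k y xk xk0 xkS|].
    rewrite -Atot.
    have := epoch_variance hn Lpos fdiff fconv fsmooth grad0 (eta0 k) (etaL k) xk0 xkS.
    by rewrite -!mulrA.
  rewrite -mulr_suml le_eqVlt; apply/orP; left; apply/eqP; congr (_ * _).
  by field; rewrite !gt_eqF.
have {bound} := bound (fun k => eta k ^+ 3 * n%:R * Lbar L * (n%:R * sigma2 f xstar)).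
move=> B; apply: (le_trans (B _)) => [k y xk xk0 xkS|].
  rewrite -(mulrA _ n%:R) -Atot -Ltot.
  have := epoch_shuffling hn Lpos fdiff fconv fsmooth grad0 (eta0 k) (etaL k) xk0 xkS.
  by rewrite -!mulrA.
rewrite -mulr_suml le_eqVlt; apply/orP; left; apply/eqP; congr (_ * _).
by field; rewrite !gt_eqF.
Qed.
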